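(* There exists $x_0$ such that for every real $x\geq x_0$ and every integer $k$ with $1\leqslant k\leqslant \log x/(5\log\log x)$, there are at least $x^{1/10}$ distinct positive integers $n\leqslant x$ with $\kappa_+(n)\geqslant k$.
   Context: Every integer $n\ge 1$ is assigned a finite rooted planar tree $t(n)$ (its prime tower factorization): $t(1)$ is the tree with a single vertex (the root) and no edges; if $n=p_1^{a_1}\cdots p_s^{a_s}$ with primes $p_1<\dots<p_s$ and $a_i\ge1$, then $t(n)$ consists of a root with $s$ edges to children, ordered from left to right, the $i$-th edge leading to a copy of the planar tree $t(a_i)$ rooted at that child. For integers $n\ge1$ and $K\ge0$ we say the observable $O(n,n+1,\ldots,n+K)$ occurs at $m\ge1$ if $t(m+j)=t(n+j)$ for all $0\le j\le K$. $\kappa_+(n)$ is the least natural number $K$ such that $O(n,n+1,\ldots,n+K)$ occurs only at $m=n$; this is well defined for all $n\ge 1$. *)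

(* Defs.v *)
From mathcomp Require Import all_boot boolp zify.

Set Implicit Arguments.
Unset Strict Implicit.
Unset Printing Implicit Defensive.

(* Finite rooted planar trees: a root with the left-to-right list of the
   subtrees at its children. *)
Inductive ptree : Type := PNode of seq ptree.

(* [prime_decomp n] lists the pairs (p_i, a_i) with p_1 < p_2 < ...  The
   recursion is on exponents, which are smaller than n, so that fuel n
   suffices: see the defining equation [ptfE]. *)
Fixpoint ptf_rec (d n : nat) : ptree :=
  if d is d'.+1 then PNode [seq ptf_rec d' pa.2 | pa <- prime_decomp n]
  else PNode [::].

Definition ptf (n : nat) : ptree := ptf_rec n n.

Lemma ptf_rec_fuel (d n : nat) : n <= d -> ptf_rec d n = ptf n.
Proof.
rewrite /ptf; elim/ltn_ind: n d => -[|n] IH [|d] //= le_nd.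
congr PNode; apply/eq_in_map => -[p a] /= /mem_prime_decomp[pr_p a0 dvd_pa].
have le_pa := dvdn_leq (ltn0Sn n) dvd_pa.
have lt_a : a < n.+1 by apply: leq_trans le_pa; exact: ltn_expl (prime_gt1 pr_p).
by rewrite (IH a lt_a d) ?(IH a lt_a n) //; lia.
Qed.

Lemma ptfE (n : nat) : ptf n = PNode [seq ptf pa.2 | pa <- prime_decomp n].
Proof.
case: n => [|n] //; rewrite {1}/ptf /=; congr PNode.
apply/eq_in_map => -[p a] /= /mem_prime_decomp[pr_p a0 dvd_pa].
have le_pa := dvdn_leq (ltn0Sn n) dvd_pa.
apply: ptf_rec_fuel.
by rewrite -ltnS; apply: leq_trans le_pa; exact: ltn_expl (prime_gt1 pr_p).
Qed.

(* The observable O(n, n+1, ..., n+K) occurs at m. *)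
Definition occurs (n K m : nat) : Prop :=
  0 < m /\ forall j, j <= K -> ptf (m + j) = ptf (n + j).

Definition occurs_only_at_self (n K : nat) : Prop :=
  forall m, occurs n K m -> m = n.

Lemma ptf_pfactor (p e : nat) : prime p -> 0 < e ->
  ptf (p ^ e) = PNode [:: ptf e].
Proof.
move=> pr_p e0.
by rewrite ptfE prime_decompE primesX // primes_prime //= pfactorK.
Qed.

Lemma ptf_pfactor_inv (x : nat) (c : ptree) : 0 < x -> ptf x = PNode [:: c] ->
  exists p e, [/\ prime p, 0 < e, x = p ^ e & ptf e = c].
Proof.
move=> x0; rewrite ptfE.
have := prod_prime_decomp x0; have := @mem_prime_decomp x.
case: prime_decomp => [|[p e] [|? ?]] //= mem_pd -> [<-].
have [pr_p e0 _] := mem_pd p e (mem_head _ _).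
by exists p, e; rewrite big_seq1.
Qed.

Lemma ptf_prime_inv (x p : nat) : 0 < x -> prime p -> ptf x = ptf p -> prime x.
Proof.
move=> x0 pr_p; rewrite -{1}(expn1 p) ptf_pfactor //.
move=> /(ptf_pfactor_inv x0)[q [e [pr_q e0 -> ]]].
rewrite ptfE; have := prod_prime_decomp e0.
by case: prime_decomp => // -> _; rewrite big_nil expn1.
Qed.

Lemma even_pfactor (p e : nat) : prime p -> ~~ odd (p ^ e) -> p = 2.
Proof. by move=> /even_prime[//|podd]; rewrite oddX podd orbT. Qed.

Lemma kappa_plus_ex (n : nat) : exists K, `[< occurs_only_at_self n K >].
Proof.
have [p n_p pr_p] := prime_above (n + 2).
have [q p_q pr_q] := prime_above p.
have n_a : n.+1 < 2 ^ n.+1 by exact: ltn_expl.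
set a := n.+1 in n_a; have a0 : 0 < a by [].
exists (q + 2 ^ a.+1); apply/asboolP => m [m0 occ].
have occ' x : n <= x <= q + 2 ^ a.+1 -> ptf (m + (x - n)) = ptf x.
  by move=> /andP[nx xq]; rewrite occ ?subnKC //; lia.
have pr_mp : prime (m + (p - n)).
  by apply: (ptf_prime_inv _ pr_p); [lia|apply: occ'; lia].
have pr_mq : prime (m + (q - n)).
  by apply: (ptf_prime_inv _ pr_q); [lia|apply: occ'; lia].
have odd_q : odd q by have [|//] := even_prime pr_q; lia.
have odd_mq : odd (m + (q - n)).
  by have [|//] := even_prime pr_mq; have := prime_gt1 pr_mp; lia.
have par : odd m = odd n by move: odd_mq; rewrite oddD oddB ?odd_q; [|lia]; lia.
have eS : 2 ^ a.+1 = 2 ^ a + 2 ^ a by rewrite expnS; lia.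
have odd_2a : odd (2 ^ a) = false by rewrite oddX.
have : ptf (m + (2 ^ a - n)) = PNode [:: ptf a].
  by rewrite -(@ptf_pfactor 2) //; apply: occ'; lia.
move=> /ptf_pfactor_inv-/(_ ltac:(lia))[s [b [pr_s b0 Eb _]]].
have : ptf (m + (2 ^ a.+1 - n)) = PNode [:: ptf a.+1].
  by rewrite -(@ptf_pfactor 2) //; apply: occ'; lia.
move=> /ptf_pfactor_inv-/(_ ltac:(lia))[r [c [pr_r c0 Ec _]]].
have r2 : r = 2 by apply: (even_pfactor pr_r (e := c)); lia.
have s2 : s = 2 by apply: (even_pfactor pr_s (e := b)); lia.
subst r s.
have Ebc : 2 ^ b + 2 ^ a = 2 ^ c by rewrite -Ec -Eb; lia.
suff ba : b = a by move: Eb; rewrite ba; lia.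
have lt_bc : b < c by rewrite -(ltn_exp2l b c (isT : 1 < 2)) -Ebc; lia.
have lt_ac : a < c.
  by rewrite -(ltn_exp2l a c (isT : 1 < 2)) -Ebc -[X in X < _]add0n ltn_add2r expn_gt0.
have le_bc : 2 ^ b.+1 <= 2 ^ c by rewrite leq_exp2l.
have le_ac : 2 ^ a.+1 <= 2 ^ c by rewrite leq_exp2l.
apply/eqP; rewrite -(eqn_exp2l b a (isT : 1 < 2)).
by move: le_bc le_ac; rewrite -Ebc !expnS; lia.
Qed.

Definition kappa_plus (n : nat) : nat := ex_minn (kappa_plus_ex n).

Lemma kappa_plusP (n : nat) : occurs_only_at_self n (kappa_plus n) /\
  forall K, occurs_only_at_self n K -> kappa_plus n <= K.
Proof.
rewrite /kappa_plus; case: ex_minnP => K /asboolP HK min.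
by split=> // K' HK'; apply/min/asboolP.
Qed.

(* Main.v *)
Require Import Defs.
From mathcomp Require Import all_boot all_order all_algebra.
From mathcomp Require Import all_classical all_reals all_analysis.
From mathcomp Require Import zify ring lra.

(** A window of length k whose sequence of trees also occurs elsewhere forces
    kappa_plus >= k, so the proof is a pigeonhole on windows with few possible
    patterns.  Put M = k!^2 and look at the windows M r + 1, ..., M r + k.  Then
    M r + j = j u with u = 1 mod k!, so the primes of u all exceed k and come
    after those of j; if moreover u is squarefree, then t(M r + j) depends only
    on j and on the number of primes of u, which is O(log x).  Hence there are
    at most (log x)^(2k) <= x^(2/5) patterns.  On the other hand, sieving out
    the squares m^2 with m > k shows that, of the Q = x / M >= x^(3/5) - 1
    values of r, at least Q / (2k + 1) - k x^(1/2) make all k cofactors u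
    squarefree. *)

Set Implicit Arguments.
Unset Strict Implicit.
Unset Printing Implicit Defensive.

Import Order.TTheory GRing.Theory Num.Theory.

Definition omega (n : nat) : nat := size (primes n).

Definition squarefree (n : nat) : bool :=
  (0 < n) && all (fun p => logn p n == 1) (primes n).

Lemma squarefree_gt0 (n : nat) : squarefree n -> 0 < n.
Proof. by case/andP. Qed.

Lemma squarefreePn (n : nat) : 0 < n -> ~~ squarefree n ->
  exists2 p, prime p & p ^ 2 %| n.
Proof.
move=> n_gt0; rewrite /squarefree n_gt0 => /allPn[p p_n logn_neq1].
have p_prime : prime p by move: p_n; rewrite mem_primes => /andP[].
exists p => //; rewrite pfactor_dvdn //.
by rewrite ltn_neqAle eq_sym logn_neq1 logn_gt0.
Qed.

Lemma expn2_omega_leq (n : nat) : 0 < n -> 2 ^ omega n <= n.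
Proof.
move=> n_gt0; rewrite {2}(prod_prime_decomp n_gt0) prime_decompE big_map /=.
rewrite /omega -[size _]card_ord -prod_nat_const.
rewrite (big_nth 0) big_mkord; apply: leq_prod => i _.
have p_n : nth 0 (primes n) i \in primes n by rewrite mem_nth.
have p_gt1 : 1 < nth 0 (primes n) i.
  by move: p_n; rewrite mem_primes => /andP[/prime_gt1].
apply: (leq_trans p_gt1); rewrite -[leqLHS]expn1.
by rewrite leq_pexp2l ?logn_gt0 // ltnW.
Qed.

Lemma omega_leq_trunc_log (n : nat) : omega n <= trunc_log 2 n.
Proof.
by case: n => // n; apply: trunc_log_max => //; exact: expn2_omega_leq.
Qed.

Lemma primesM_cat (m n : nat) : 0 < m -> 0 < n ->
  allrel ltn (primes m) (primes n) -> primes (m * n) = primes m ++ primes n.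
Proof.
move=> m_gt0 n_gt0 lt_mn.
apply: (irr_sorted_eq ltn_trans ltnn (sorted_primes _)); last first.
  by move=> p; rewrite mem_cat primesM.
rewrite (sorted_pairwise ltn_trans) pairwise_cat lt_mn.
by rewrite -!(sorted_pairwise ltn_trans) !sorted_primes.
Qed.

Lemma prime_decompM_cat (m n : nat) : 0 < m -> 0 < n ->
    allrel ltn (primes m) (primes n) ->
  prime_decomp (m * n) = prime_decomp m ++ prime_decomp n.
Proof.
move=> m_gt0 n_gt0 lt_mn; rewrite !prime_decompE primesM_cat // map_cat.
have logn0 p r : p \notin primes r -> logn p r = 0.
  by rewrite -logn_gt0 lt0n negbK => /eqP.
congr cat; apply/eq_in_map => p p_in; rewrite lognM //.
  rewrite (logn0 p n) ?addn0 //; apply/negP => p_n.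
  by have := allrelP lt_mn _ _ p_in p_n; rewrite /= ltnn.
rewrite (logn0 p m) //; apply/negP => p_m.
by have := allrelP lt_mn _ _ p_m p_in; rewrite /= ltnn.
Qed.

Lemma ptf_mul_squarefree (m n : nat) : 0 < m -> squarefree n ->
    allrel ltn (primes m) (primes n) ->
  ptf (m * n) = PNode ([seq ptf pa.2 | pa <- prime_decomp m]
                       ++ nseq (omega n) (ptf 1)).
Proof.
move=> m_gt0 sqf_n lt_mn; have n_gt0 := squarefree_gt0 sqf_n.
have /all_pred1P exponents : all (pred1 1) [seq logn p n | p <- primes n].
  by rewrite all_map; case/andP: sqf_n.
rewrite ptfE prime_decompM_cat // map_cat; congr (PNode (_ ++ _)).
rewrite prime_decompE -map_comp (map_comp ptf (logn^~ n)) exponents.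
by rewrite map_nseq size_map.
Qed.

Lemma leq_kappa_plus (n m k : nat) : 0 < m -> m != n ->
  (forall i, i < k -> ptf (m + i) = ptf (n + i)) -> k <= kappa_plus n.
Proof.
move=> m_gt0 /eqP neq_mn eq_mn; rewrite leqNgt; apply/negP => lt_k.
apply/neq_mn/(kappa_plusP n).1; split=> // i le_i.
exact/eq_mn/(leq_ltn_trans le_i).
Qed.

Definition large_kappa_plus (k N : nat) : seq nat :=
  [seq n <- iota 1 N | k <= kappa_plus n].

Lemma mem_large_kappa_plus (k N n : nat) :
  (n \in large_kappa_plus k N) = (0 < n <= N) && (k <= kappa_plus n).
Proof. by rewrite mem_filter mem_iota add1n ltnS andbC. Qed.

Lemma card_bigcup_leq (I T : finType) (P : pred I) (F : I -> {set T}) :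
  #|\bigcup_(i | P i) F i| <= \sum_(i | P i) #|F i|.
Proof.
elim/big_rec2: _ => [|i n A _ leA]; first by rewrite cards0.
by apply: leq_trans (leq_card_setU _ _) _; rewrite leq_add2l.
Qed.

Definition collisions (T U : finType) (A : {set T}) (f : T -> U) : {set T} :=
  [set x in A | [exists y in A, (y != x) && (f y == f x)]].

Lemma leq_card_collisions (T U : finType) (A : {set T}) (f : T -> U) :
  #|A| <= #|collisions A f| + #|U|.
Proof.
have sub_A : collisions A f \subset A.
  by apply/fintype.subsetP => x; rewrite inE => /andP[].
rewrite -(cardsID (collisions A f) A) (finset.setIidPr sub_A) leq_add2l.
apply: (@leq_card_in _ _ f) => x y.
rewrite !inE => /andP[+ x_A] /andP[_ y_A] eq_f; rewrite x_A /=.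
by move/existsPn/(_ y); rewrite y_A eq_f eqxx andbT negbK => /eqP.
Qed.

Lemma card_dvdn_affine (Q a b d : nat) : coprime a b ->
  #|[set r : 'I_Q | d %| a * r + b]| <= (Q %/ d).+1.
Proof.
move=> co_ab.
have quot_lt (r : 'I_Q) : r %/ d < (Q %/ d).+1.
  by rewrite ltnS leq_div2r // ltnW.
rewrite -[X in _ <= X]card_ord.
apply: (@leq_card_in _ _ (fun r : 'I_Q => Ordinal (quot_lt r))) => r r'.
wlog le_rr : r r' / r' <= r.
  move=> W rS r'S E; case: (leqP r' r) => [/W|/ltnW/W]; first exact.
  by move=> W'; apply/esym/W'.
rewrite !inE => dvd_r dvd_r' [eq_quot]; apply: val_inj => /=.
have co_da : coprime d a.
  by apply: coprime_dvdl dvd_r _; rewrite coprime_sym /coprime mulnC gcdnMDl.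
have : d %| r - r'.
  by rewrite -(Gauss_dvdr _ co_da) mulnBr -(subnDr b) dvdn_sub.
rewrite -eqn_mod_dvd // => /eqP eq_mod.
by rewrite (divn_eq r d) eq_quot eq_mod -divn_eq.
Qed.

(* The midpoint bound 1/m^2 <= 1/(m - 1/2) - 1/(m + 1/2) telescopes; the crude
   tail bound 1/k, summed over the k positions of a window, would remove every
   window. *)
Lemma sum_inv_sqr_leq (F : realFieldType) (k Y : nat) :
  (\sum_(k.+1 <= m < Y.+1) ((m ^ 2)%:R)^-1 <= 2 / (2 * k%:R + 1) :> F)%R.
Proof.
pose midpoint (m : nat) : F := (2 / (2 * m%:R + 1))%R.
have midpoint_ge0 m : (0 <= midpoint m)%R.
  by rewrite divr_ge0 // addr_ge0 // mulr_ge0.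
have [le_kY|lt_Yk] := leqP k Y; last by rewrite big_geq // 1?ltnW.
apply: (@le_trans _ _ (midpoint k - midpoint Y)%R); last by rewrite gerBl.
rewrite -opprB -telescope_sumr // -sumrN big_add1 /=.
apply: ler_sum_nat => m _; rewrite /midpoint natrX -natr1.
have : (0 <= m%:R :> F)%R by [].
move: (m%:R)%R => y y_ge0; rewrite -subr_ge0.
have -> : (- (2 / (2 * (y + 1) + 1) - 2 / (2 * y + 1)) - ((y + 1) ^+ 2)^-1 =
           ((2 * y + 1) * (2 * y + 3) * (y + 1) ^+ 2)^-1)%R.
  by field; rewrite !lt0r_neq0 //; lra.
by rewrite invr_ge0 !mulr_ge0 // ?exprn_ge0 //; lra.
Qed.

Lemma sum_divn_sqr_leq (Q k Y : nat) :
  k.*2.+1 * (\sum_(k.+1 <= m < Y.+1) Q %/ m ^ 2) <= 2 * Q.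
Proof.
rewrite -(ler_nat rat) !natrM natr_sum.
have -> : (k.*2.+1%:R = 2 * k%:R + 1 :> rat)%R.
  by rewrite -natr1 -muln2 natrM mulrC.
have k_ge0 : (0 <= k%:R :> rat)%R by [].
rewrite mulrC -ler_pdivlMr; last by lra.
apply: (@le_trans _ _ (\sum_(k.+1 <= m < Y.+1) Q%:R * ((m ^ 2)%:R)^-1)%R).
  apply: ler_sum_nat => m /andP[km _].
  rewrite ler_pdivlMr ?ltr0n ?expn_gt0 ?(leq_ltn_trans _ km) //.
  by rewrite -natrM ler_nat leq_divM.
by rewrite -mulr_sumr [(2 * _)%R]mulrC -mulrA ler_wpM2l // sum_inv_sqr_leq.
Qed.

Lemma card_nonsquarefree_affine (Q a b k Y : nat) : coprime a b ->
    (forall r : 'I_Q, 0 < a * r + b < Y.+1 ^ 2) ->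
    (forall r : 'I_Q, all (ltn k) (primes (a * r + b))) ->
  k.*2.+1 * #|[set r : 'I_Q | ~~ squarefree (a * r + b)]|
    <= 2 * Q + k.*2.+1 * Y.
Proof.
move=> co_ab bound rough.
pose div_sqr (m : nat) := [set r : 'I_Q | m ^ 2 %| a * r + b].
have sub : [set r : 'I_Q | ~~ squarefree (a * r + b)]
           \subset \bigcup_(m : 'I_Y.+1 | k < m) div_sqr m.
  apply/fintype.subsetP => r; rewrite inE.
  have /andP[val_gt0 val_lt] := bound r.
  move=> /(squarefreePn val_gt0)[p p_prime dvd_p].
  have lt_pY : p < Y.+1.
    by rewrite -ltn_sqr; apply: leq_ltn_trans val_lt; exact: dvdn_leq.
  apply/finset.bigcupP; exists (Ordinal lt_pY); last by rewrite inE.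
  apply: (allP (rough r)); rewrite mem_primes p_prime val_gt0.
  by apply: dvdn_trans dvd_p; exact: dvdn_mulr.
apply: leq_trans (_ : _ <= k.*2.+1 * \sum_(k.+1 <= m < Y.+1) (Q %/ m ^ 2).+1) _.
  rewrite leq_mul2l; apply/orP; right.
  apply: leq_trans (subset_leq_card sub) (leq_trans (card_bigcup_leq _ _) _).
  rewrite (big_nat_widenl _ 0) // big_mkord.
  by apply: leq_sum => m _; exact: card_dvdn_affine.
under eq_bigr do rewrite -addn1.
rewrite big_split /= sum_nat_const_nat muln1 mulnDr.
rewrite leq_add ?sum_divn_sqr_leq //.
by rewrite leq_mul2l subSS leq_subr orbT.
Qed.

Definition cofactor (k j r : nat) : nat := k`! * (k`! %/ j) * r + 1.

Lemma cofactorE (k j r : nat) : 0 < j <= k ->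
  k`! ^ 2 * r + j = j * cofactor k j r.
Proof.
move=> j_le; rewrite /cofactor mulnDr muln1 mulnA [j * (_ * _)]mulnCA.
by rewrite [j * _]mulnC divnK ?dvdn_fact.
Qed.

Lemma all_primes_cofactor_gt (k j r : nat) :
  all (ltn k) (primes (cofactor k j r)).
Proof.
apply/allP => p; rewrite mem_primes => /and3P[p_prime _ dvd_p] /=.
rewrite ltnNge; apply/negP => le_pk; have := prime_gt1 p_prime.
have dvd_fact : p %| k`! * (k`! %/ j) * r.
  by rewrite -mulnA dvdn_mulr // dvdn_fact // prime_gt0.
by move: dvd_p; rewrite dvdn_addr // dvdn1 => /eqP->.
Qed.

Lemma allrel_ltn_primes_cofactor (k j r : nat) : 0 < j <= k ->
  allrel ltn (primes j) (primes (cofactor k j r)).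
Proof.
move=> /andP[j_gt0 le_jk]; apply/allrelP => p q.
rewrite mem_primes => /and3P[_ _ dvd_p] /(allP (all_primes_cofactor_gt _ _ _)).
exact/leq_ltn_trans/(leq_trans (dvdn_leq j_gt0 dvd_p)).
Qed.

Definition squarefree_window (k r : nat) : bool :=
  [forall j : 'I_k, squarefree (cofactor k j.+1 r)].

Lemma leq_kappa_plus_window (k r r' : nat) : r' != r ->
    squarefree_window k r -> squarefree_window k r' ->
    (forall j : 'I_k,
       omega (cofactor k j.+1 r') = omega (cofactor k j.+1 r)) ->
  k <= kappa_plus (k`! ^ 2 * r + 1).
Proof.
move=> neq_r /forallP sqf_r /forallP sqf_r' eq_omega.
apply: (@leq_kappa_plus _ (k`! ^ 2 * r' + 1)); first by rewrite addn1.
  by rewrite eqn_add2r eqn_pmul2l // expn_gt0 fact_gt0.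
move=> i lt_ik; pose j := Ordinal lt_ik; rewrite -!addnA !add1n !cofactorE //.
by rewrite !ptf_mul_squarefree ?allrel_ltn_primes_cofactor ?(eq_omega j) //;
  [exact: (sqf_r j)|exact: (sqf_r' j)].
Qed.

Definition num_windows (k N : nat) : nat := N %/ k`! ^ 2.

Lemma leq_sqr_fact (k : nat) : k <= k`! ^ 2.
Proof.
by apply: leq_trans (fact_geq k) _; rewrite leq_pmulr ?fact_gt0.
Qed.

Lemma window_leq (k r j N : nat) : j <= k`! ^ 2 -> r < num_windows k N ->
  k`! ^ 2 * r + j <= N.
Proof.
rewrite /num_windows leq_divRL ?expn_gt0 ?fact_gt0 // => j_le; apply: leq_trans.
by rewrite mulSn addnC mulnC leq_add2r.
Qed.

Lemma cofactor_leq (k r j N : nat) : 0 < j <= k -> r < num_windows k N ->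
  cofactor k j r <= N.
Proof.
move=> /andP[j_gt0 le_jk] /(window_leq (leq_trans le_jk (leq_sqr_fact k))).
by apply: leq_trans; rewrite cofactorE ?j_gt0 // leq_pmull.
Qed.

Lemma card_squarefree_window (k N Y : nat) : N < Y.+1 ^ 2 ->
  num_windows k N <= k.*2.+1 *
    (#|[set r : 'I_(num_windows k N) | squarefree_window k r]| + k * Y).
Proof.
set Q := num_windows k N => lt_NY; set good := [set r | _].
pose bad (j : 'I_k) := [set r : 'I_Q | ~~ squarefree (cofactor k j.+1 r)].
have card_bad j : k.*2.+1 * #|bad j| <= 2 * Q + k.*2.+1 * Y.
  apply: card_nonsquarefree_affine => [|r|r].
  - exact: coprimen1.
  - rewrite addn_gt0 orbT; apply: leq_ltn_trans lt_NY.
    exact: (@cofactor_leq k r j.+1 N (ltn_ord j) (ltn_ord r)).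
  - exact: all_primes_cofactor_gt.
have sub : ~: good \subset \bigcup_j bad j.
  apply/fintype.subsetP => r; rewrite !inE => /forallPn[j nsqf].
  by apply/finset.bigcupP; exists j; rewrite ?inE.
have card_compl : k.*2.+1 * #|~: good| <= k * (2 * Q + k.*2.+1 * Y).
  apply: (@leq_trans (\sum_j k.*2.+1 * #|bad j|)); last first.
    by rewrite -[k in k * _]card_ord -sum_nat_const; exact: leq_sum.
  rewrite -big_distrr leq_mul2l /=.
  exact: leq_trans (subset_leq_card sub) (card_bigcup_leq _ _).
have : #|good| + #|~: good| = Q by rewrite cardsC card_ord.
by move: card_compl; rewrite -mul2n; nia.
Qed.

Definition omega_profile (k N : nat) (r : 'I_(num_windows k N)) :
    {ffun 'I_k -> 'I_(trunc_log 2 N).+1} :=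
  [ffun j : 'I_k => inord (omega (cofactor k j.+1 r))].

Lemma omega_profileE (k N : nat) (r : 'I_(num_windows k N)) (j : 'I_k) :
  omega_profile r j = omega (cofactor k j.+1 r) :> nat.
Proof.
rewrite ffunE inordK // ltnS; apply: leq_trans (omega_leq_trunc_log _) _.
exact: leq_trunc_log (@cofactor_leq k r j.+1 N (ltn_ord j) (ltn_ord r)).
Qed.

Lemma num_windows_leq_large_kappa_plus (k N Y : nat) : N < Y.+1 ^ 2 ->
  num_windows k N <= k.*2.+1 *
    (size (large_kappa_plus k N) + (trunc_log 2 N).+1 ^ k + k * Y).
Proof.
move=> lt_NY; apply: leq_trans (card_squarefree_window k lt_NY) _.
rewrite leq_mul2l leq_add2r /=; set windows := [set r | _].
have := leq_card_collisions windows (@omega_profile k N).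
rewrite card_ffun !card_ord => /leq_trans; apply; rewrite leq_add2r.
pose start (r : 'I_(num_windows k N)) := k`! ^ 2 * r + 1.
have start_inj : injective start.
  move=> r r' /eqP; rewrite eqn_add2r eqn_pmul2l ?expn_gt0 ?fact_gt0 //.
  by move=> /eqP/val_inj.
rewrite cardE -(size_map start); apply: uniq_leq_size.
  by rewrite map_inj_uniq ?enum_uniq.
move=> _ /mapP[r + ->]; rewrite mem_enum !inE => /andP[win_r].
move=> /existsP[r' /and3P[+ neq_r /eqP eq_profile]]; rewrite inE => win_r'.
rewrite mem_large_kappa_plus addn_gt0 orbT window_leq ?expn_gt0 ?fact_gt0 //=.
apply: (leq_kappa_plus_window neq_r win_r win_r') => j.
by rewrite -!omega_profileE eq_profile.
Qed.

Lemma fact_leq_expn (n : nat) : n`! <= n ^ n.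
Proof.
elim: n => // n IH; rewrite factS expnS leq_mul2l /=.
by apply: leq_trans IH _; case: n => // n; rewrite leq_exp2r.
Qed.

Local Open Scope ring_scope.

Lemma ln2_ge_half (R : realType) : 1 / 2 <= ln 2 :> R.
Proof.
have /le_ln1Dx : (-1 < - (1 / 2) :> R) by lra.
have -> : 1 + - (1 / 2) = 2^-1 :> R by field.
by rewrite lnV ?posrE //; lra.
Qed.

Lemma trunc_log_le_ln (R : realType) (p n : nat) : (1 < p)%N -> (0 < n)%N ->
  (trunc_log p n)%:R * ln p%:R <= ln n%:R :> R.
Proof.
move=> p_gt1 n_gt0; have p_gt0 := ltnW p_gt1.
rewrite mulr_natl -lnXn ?ltr0n // -natrX.
by rewrite ler_ln ?posrE ?ltr0n ?expn_gt0 ?p_gt0 // ler_nat trunc_logP.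
Qed.

Lemma exprn_ln_le_powR (R : realType) (x c : R) (n : nat) : 0 < ln x ->
  n%:R * ln (ln x) <= c * ln x -> ln x ^+ n <= x `^ c.
Proof.
move=> ln_gt0 le_c.
have x_neq0 : x != 0 by apply: contraTneq ln_gt0 => ->; rewrite ln0 ?ltxx.
rewrite /powR (negPf x_neq0) -[X in X ^+ n]lnK ?posrE //.
by rewrite -expRM_natl ler_expR.
Qed.

Lemma mul_sqr_le_expR (R : realType) (a c : R) : 0 <= a -> 24 * c <= a ^+ 2 ->
  c * a ^+ 2 <= expR a.
Proof.
move=> a_ge0 c_le; apply: le_trans (expR_ge1Dxn 3 a_ge0).
have -> : 4`! = 24%N by [].
have : 24 * c * a ^+ 2 <= a ^+ 2 * a ^+ 2 by rewrite ler_wpM2r ?sqr_ge0.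
by rewrite -exprD; lra.
Qed.

Lemma le_of_sieve_bound (F : realFieldType) (l z q s : F) :
    1 <= l -> 10 * l ^+ 2 <= z -> z ^+ 6 <= q + 1 ->
    q <= 3 * l * (s + z ^+ 4 + l * z ^+ 5) ->
  z <= s.
Proof.
move=> l_ge1 le_z le_q q_le; rewrite leNgt; apply/negP => lt_sz.
have z_ge1 : 1 <= z by nra.
have z4_le : z ^+ 4 <= z ^+ 5 by rewrite ler_weXn2l.
have z_le : z <= z ^+ 5 by rewrite -[leLHS]expr1 ler_weXn2l.
have z5_ge1 : 1 <= z ^+ 5 by rewrite exprn_ege1.
have z6_ge : 10 * l ^+ 2 * z ^+ 5 <= z ^+ 6.
  by rewrite exprS ler_wpM2r // exprn_ge0; lra.
move: (z ^+ 6) (z ^+ 5) (z ^+ 4) => z6 z5 z4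
  in le_q q_le z4_le z_le z5_ge1 z6_ge *.
have q_lt : q < 3 * l * ((l + 2) * z5).
  by apply: le_lt_trans q_le _; rewrite ltr_pM2l; lra.
have : 0 <= (7 * l ^+ 2 - 6 * l - 1) * z5 by rewrite mulr_ge0 //; nra.
by nra.
Qed.

Lemma ln_ge1 (R : realType) (x : R) : 4 <= x -> 1 <= ln x.
Proof.
move=> x_ge4; have : ln (2 ^+ 2) <= ln x by rewrite ler_ln ?posrE; lra.
by rewrite lnXn // mulr2n; have := ln2_ge_half R; lra.
Qed.

Lemma exprn_powR (R : realType) (x c : R) (n : nat) :
  (x `^ c) ^+ n = x `^ (c * n%:R).
Proof. by rewrite -powR_mulrn ?powR_ge0 // -powRrM. Qed.

Lemma fact_le_exprn (F : realFieldType) (l : F) (n : nat) :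
  n%:R <= l -> n`!%:R <= l ^+ n.
Proof.
move=> n_le; apply: (@le_trans _ _ (n ^ n)%:R).
  by rewrite ler_nat fact_leq_expn.
by rewrite natrX lerXn2r ?nnegrE // (le_trans _ n_le).
Qed.

Lemma trunc_log_succ_le_sqr_ln (R : realType) (x : R) (n : nat) :
  3 <= ln x -> n%:R <= x -> (trunc_log 2 n).+1%:R <= ln x ^+ 2.
Proof.
move=> ln_ge3 n_le; have [->|n_gt0] := posnP n.
  by rewrite trunc_log0; nra.
have ln_le : ln n%:R <= ln x.
  by rewrite ler_ln ?posrE ?ltr0n // (lt_le_trans _ n_le) ?ltr0n.
have := trunc_log_le_ln R (isT : (1 < 2)%N) n_gt0.
have : (trunc_log 2 n)%:R * (1 / 2) <= (trunc_log 2 n)%:R * ln 2 :> R.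
  by rewrite ler_wpM2l // ln2_ge_half.
have : 3 * ln x <= ln x ^+ 2 by rewrite expr2 ler_wpM2r; lra.
by rewrite -natr1; lra.
Qed.

Lemma lt_mul_divn_truncS (R : realType) (x y : R) (M : nat) :
  (0 < M)%N -> M%:R <= y -> x < y * ((Num.trunc x %/ M)%:R + 1).
Proof.
move=> M_gt0 M_le; apply: lt_le_trans (truncnS_gt x) _.
rewrite natr1; apply: (@le_trans _ _ (M * (Num.trunc x %/ M).+1)%:R).
  by rewrite ler_nat mulnC ltn_ceil.
by rewrite natrM ler_wpM2r.
Qed.

Section WindowCount.

Variables (R : realType) (z : R) (k : nat).
Local Notation x := (z ^+ 10).
Hypotheses (z_gt0 : 0 < z) (exp_ln_le : ln x ^+ k <= z ^+ 2).
Hypothesis (k_le_ln : k%:R <= ln x).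

Lemma exprn6_le_num_windows :
  z ^+ 6 <= (num_windows k (Num.trunc x))%:R + 1.
Proof.
have z_ge0 := ltW z_gt0; have fact_sqr_le : (k`! ^ 2)%:R <= z ^+ 4.
  rewrite natrX (exprM z 2 2) lerXn2r ?nnegrE ?exprn_ge0 //.
  exact: le_trans (fact_le_exprn k_le_ln) exp_ln_le.
rewrite -(ler_pM2l (exprn_gt0 4 z_gt0)) -exprD ltW // lt_mul_divn_truncS //.
by rewrite expn_gt0 fact_gt0.
Qed.

Lemma num_windows_le_large_kappa_plus : 3 <= ln x ->
  (num_windows k (Num.trunc x))%:R <=
    3 * ln x *
    ((size (large_kappa_plus k (Num.trunc x)))%:R + z ^+ 4
     + ln x * z ^+ 5).
Proof.
move: exp_ln_le k_le_ln; set l := ln _; set N := Num.trunc _.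
move=> exp_l_le k_le l_ge3; have z_ge0 := ltW z_gt0.
have N_le : N%:R <= x by rewrite truncn_le exprn_ge0.
pose Y := Num.trunc (z ^+ 5).
have Y_le : Y%:R <= z ^+ 5 by rewrite truncn_le exprn_ge0.
have lt_NY : (N < Y.+1 ^ 2)%N.
  rewrite -(ltr_nat R); apply: le_lt_trans N_le _.
  by rewrite natrX (exprM z 5 2) ltrXn2r ?nnegrE ?exprn_ge0 ?truncnS_gt.
have profiles_le : ((trunc_log 2 N).+1 ^ k)%:R <= z ^+ 4.
  rewrite natrX; apply: (@le_trans _ _ ((l ^+ 2) ^+ k)).
    by rewrite lerXn2r ?nnegrE ?exprn_ge0 ?trunc_log_succ_le_sqr_ln //; lra.
  by rewrite exprAC (exprM z 2 2) lerXn2r ?nnegrE ?exprn_ge0 //; lra.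
have := num_windows_leq_large_kappa_plus k lt_NY.
rewrite -(ler_nat R) => /le_trans; apply.
rewrite natrM ler_pM ?ler0n //.
  by rewrite -natr1 -muln2 natrM; lra.
by rewrite !natrD lerD ?lerD // natrM ler_pM.
Qed.

End WindowCount.

Lemma powR_le_size_large_kappa_plus (R : realType) (x : R) (k : nat) :
    expR 2000 <= x -> k%:R <= ln x / (5 * ln (ln x)) ->
  x `^ (1 / 10) <= (size (large_kappa_plus k (Num.trunc x)))%:R.
Proof.
move=> x_ge k_le; have x_gt0 : 0 < x by rewrite (lt_le_trans _ x_ge) ?expR_gt0.
have ln_ge : 2000 <= ln x by rewrite -[leLHS]expRK ler_ln ?posrE ?expR_gt0.
have lnln_ge1 : 1 <= ln (ln x) by apply: ln_ge1; lra.
have mul_lnln_le : k%:R * ln (ln x) <= 1 / 5 * ln x.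
  by move: k_le; rewrite ler_pdivlMr; lra.
have k_le_ln : k%:R <= ln x.
  have : 0 <= k%:R * (ln (ln x) - 1) by rewrite mulr_ge0 //; lra.
  by lra.
set z := x `^ _.
have z_gt0 : 0 < z by rewrite powR_gt0.
have xE : x = z ^+ 10.
  by rewrite exprn_powR divfK ?powRr1 // ltW.
have exp_ln_le : ln x ^+ k <= z ^+ 2.
  rewrite exprn_powR; apply: exprn_ln_le_powR; first by lra.
  by apply: le_trans mul_lnln_le _; lra.
have z_ge : 10 * ln x ^+ 2 <= z.
  have -> : z = expR (ln x / 10).
    by rewrite /z /powR gt_eqF //; congr expR; field.
  have -> : 10 * ln x ^+ 2 = 1000 * (ln x / 10) ^+ 2 by field.
  by apply: mul_sqr_le_expR; [lra|nra].
clearbody z; subst x.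
have num_windows_ge := exprn6_le_num_windows z_gt0 exp_ln_le k_le_ln.
apply: (le_of_sieve_bound _ z_ge num_windows_ge); first by lra.
by apply: num_windows_le_large_kappa_plus => //; lra.
Qed.

Theorem theorem1 (R : realType) :
  exists x0 : R, forall x : R, x0 <= x ->
  forall k : nat, (1 <= k)%N -> k%:R <= ln x / (5 * ln (ln x)) ->
  exists s : seq nat,
    [/\ uniq s,
        forall n : nat, n \in s ->
          [/\ (1 <= n)%N, n%:R <= x & (k <= kappa_plus n)%N]
      & x `^ (1 / 10) <= (size s)%:R].
Proof.
exists (expR 2000) => x x_ge k _ k_le.
exists (large_kappa_plus k (Num.trunc x)); split.
- by rewrite filter_uniq ?iota_uniq.
- move=> n; rewrite mem_large_kappa_plus => /andP[/andP[n_gt0 n_le] k_le_kappa].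
  split=> //; apply: le_trans (_ : (Num.trunc x)%:R <= x).
    by rewrite ler_nat.
  by rewrite truncn_le // (le_trans _ x_ge) ?expR_ge0.
- exact: powR_le_size_large_kappa_plus.
Qed.
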